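(* Let $D$ be a normalized set in a Banach space $X$ with modulus of smoothness $\rho$, and let $c>1$. Suppose that $\rho(\tau)/\tau\le (4c)^{-1}$ for some $\tau\in(0,1)$. (1) If $D$ is a $c$-ARS in $X$, then, letting $t=2\tau/3$ and $\varepsilon=1-\tau/(3c)$, the set $\pm tD=\{td: d\in D\}\cup\{-td:d\in D\}$ is an $\varepsilon$-net of $B(X)$. (2) Conversely, if $t>0$, $0<\varepsilon<1$ and the set $\pm tD$ is an $\varepsilon$-net of $B(X)$, then $D$ is a $c'$-ARS in $X$ for some constant $c'$ depending only on $t$ and $\varepsilon$.
   Context: Banach spaces are real and nonzero; $B(X)$ is the closed unit ball of $X$. A set is normalized if all its elements have norm $1$. The modulus of smoothness of $X$ is $\rho(\tau)=\sup\{(\|x+y\|+\|x-y\|)/2-1 : x,y\in X,\ \|x\|=1,\ \|y\|\le\tau\}$ for $\tau>0$. A set $D\subset X$ is a $c$-ARS ($c$-absolutely representing system) in $X$ if every $x\in B(X)$ can be written as $x=\sum_{i=1}^\infty a_i x_i$ with scalars $a_i$, elements $x_i\in D$ (repetitions allowed), and $\sum_{i=1}^\infty\|a_i x_i\|\le c$. A set $A\subset X$ is an $\varepsilon$-net of a set $K\subset X$ if for every $x\in K$ there is $y\in A$ with $\|x-y\|\le\varepsilon$ ($A$ need not be contained in $K$). *)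

(* Defs.v *)
From mathcomp Require Import all_boot all_order all_algebra.
From mathcomp Require Import all_classical all_reals all_analysis.
Import Order.TTheory GRing.Theory Num.Theory.
Import numFieldNormedType.Exports.

Set Implicit Arguments.
Unset Strict Implicit.
Unset Printing Implicit Defensive.

Local Open Scope classical_set_scope.
Local Open Scope ring_scope.

Section BanachDefs.
Context {R : realType} {X : completeNormedModType R}.

Definition unit_ball : set X := [set x | `|x| <= 1].

Definition normalized (D : set X) : Prop := forall d, D d -> `|d| = 1.

(* If X is nonzero and 0 <= tau, the set below is nonempty and bounded above by
   tau, so the real-valued [sup] is the true supremum. *)
Definition modulus_of_smoothness (tau : R) : R :=
  sup [set r | exists x y : X, [/\ `|x| = 1, `|y| <= tau &
                 r = (`|x + y| + `|x - y|) / 2 - 1]].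

Definition is_ARS (c : R) (D : set X) : Prop :=
  forall x, unit_ball x ->
    exists (a : R^nat) (d : nat -> X),
      [/\ forall i, D (d i),
          series (fun i => a i *: d i) @ \oo --> x &
          (\sum_(0 <= i <oo) `|a i *: d i|%:E <= c%:E)%E].

Definition is_net (eps : R) (A K : set X) : Prop :=
  forall x, K x -> exists2 y, A y & `|x - y| <= eps.

Definition pm_scale (t : R) (D : set X) : set X :=
  [set t *: d | d in D] `|` [set - (t *: d) | d in D].

End BanachDefs.

Arguments unit_ball {R} X.
Arguments modulus_of_smoothness {R} X tau.

(* Main.v *)
(** (1) For a unit vector [x = \sum a_i d_i] with [W = \sum |a_i| <= c], Jensen's
    inequality for the norm applied to
    [(1 + tau / W) x = \sum (|a_i| / W) (x + tau sg(a_i) d_i)] yields an [i] with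
    [|x + tau sg(a_i) d_i| >= 1 + tau / c], so no support functional is needed.
    The smoothness bound then makes the norm at the opposite point
    [x - tau sg(a_i) d_i] at most [1 - tau / (2c)], and convexity of the norm
    gives the rest.

    (2) Approximating the remainder, rescaled by [eps^-1], again and again by
    elements of [±tD] gives [x = \sum eps^i y_i] with [|y_i| = t], whence the
    constant [t / (1 - eps)]. *)
Require Import Defs.
From mathcomp Require Import all_boot all_order all_algebra.
From mathcomp Require Import all_classical all_reals all_analysis.
From mathcomp Require Import ring lra.
Import Order.TTheory GRing.Theory Num.Theory.
Import numFieldNormedType.Exports.
Set Implicit Arguments.
Unset Strict Implicit.
Unset Printing Implicit Defensive.
Local Open Scope classical_set_scope.
Local Open Scope ring_scope.

Lemma modulus_of_smoothnessP (R : realType) (X : completeNormedModType R)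
    (tau : R) (x y : X) : `|x| = 1 -> `|y| <= tau ->
  `|x + y| + `|x - y| <= 2 * (1 + modulus_of_smoothness X tau).
Proof.
move=> x1 ytau.
suff : (`|x + y| + `|x - y|) / 2 - 1 <= modulus_of_smoothness X tau by lra.
apply: ub_le_sup; last by exists x, y.
exists tau => _ [u [v [u1 vtau ->]]].
have := ler_normD u v; have := ler_normB u v; lra.
Qed.

(** Partial sums suffice: if every direction fell short, one index with [a i != 0] would keep a
    fixed positive deficit in Jensen's inequality, while the error from truncating the series tends
    to 0. *)
Lemma cvg_series_norm_direction (R : realType) (X : completeNormedModType R)
    (c tau : R) (x : X) (a : R^nat) (d : nat -> X) :
  0 < c -> 0 < tau -> `|x| = 1 ->
  series (fun i => a i *: d i) @ \oo --> x ->
  (forall n, \sum_(0 <= i < n) `|a i| <= c) ->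
  exists2 i, a i != 0 & 1 + tau / c <= `|x + tau *: (Num.sg (a i) *: d i)|.
Proof.
move=> c0 tau0 x1 cvx ac; apply: contrapT => noi.
have lt_dir i : a i != 0 -> `|x + tau *: (Num.sg (a i) *: d i)| < 1 + tau / c.
  by move=> ai0; rewrite ltNge; apply/negP => h; apply: noi; exists i.
have [i0 ai0] : exists i, a i != 0.
  apply: contrapT => a0.
  have a_eq0 i : a i = 0 by apply: contrapT => /eqP h; apply: a0; exists i.
  have x0 : x = 0.
    apply: (cvg_unique _ cvx); first exact: norm_hausdorff.
    rewrite (_ : series _ = cst 0); first exact: cvg_cst.
    apply/funext => n; rewrite /series /= big1// => i _.
    by rewrite a_eq0 scale0r.
  by move: x1; rewrite x0 normr0 => /esym/eqP; rewrite oner_eq0.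
(* Deficit of the term [i], weighted by [|a i|] so that nothing is divided by the total weight and
   zero coefficients contribute 0. *)
pose gap i := `|a i| * (1 + tau / c) - `| `|a i| *: x + tau *: (a i *: d i)|.
have gapE i : gap i =
    `|a i| * (1 + tau / c - `|x + tau *: (Num.sg (a i) *: d i)|).
  rewrite /gap mulrBr; congr (_ - _).
  rewrite -[X in X * `|_ + _|]normr_id -normrZ scalerDr; congr `|_ + _|.
  rewrite !scalerA; congr (_ *: _).
  by rewrite {1}(numEsg (a i)); ring.
have gap_ge0 i : 0 <= gap i.
  rewrite gapE; have [->|/lt_dir h] := eqVneq (a i) 0.
    by rewrite normr0 mul0r.
  by rewrite mulr_ge0// subr_ge0 ltW.
have gap_gt0 : 0 < gap i0.
  by rewrite gapE mulr_gt0 ?normr_gt0// subr_gt0 lt_dir.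
pose S n := series (fun i => a i *: d i) n.
have far n : (i0 < n)%N -> gap i0 <= tau * `|x - S n|.
  move=> i0n; pose W := \sum_(0 <= i < n) `|a i|.
  have W0 : 0 <= W by rewrite sumr_ge0.
  have upper : `|W *: x + tau *: S n| <= W * (1 + tau / c) - gap i0.
    have -> : W *: x + tau *: S n =
        \sum_(0 <= i < n) (`|a i| *: x + tau *: (a i *: d i)).
      by rewrite big_split/= -scaler_suml -scaler_sumr.
    apply: le_trans (ler_norm_sum _ _ _) _.
    have -> : W * (1 + tau / c) = \sum_(0 <= i < n)
        (`| `|a i| *: x + tau *: (a i *: d i)| + gap i).
      by rewrite mulr_suml; apply: eq_bigr => i _; rewrite /gap; ring.
    rewrite big_split/= -addrA lerDl subr_ge0.
    rewrite (bigD1_seq i0) ?mem_index_iota ?iota_uniq//=.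
    by rewrite lerDl sumr_ge0.
  (* [W *: x + tau *: S n] misses [(W + tau) *: x] only by the truncation error
     [tau *: (x - S n)]. *)
  have lower : W + tau <= `|W *: x + tau *: S n| + tau * `|x - S n|.
    have -> : W + tau = `|(W *: x + tau *: S n) + tau *: (x - S n)|.
      rewrite scalerBr -addrA [tau *: S n + _]addrC subrK -scalerDl normrZ x1.
      by rewrite mulr1 ger0_norm// addr_ge0// ltW.
    apply: le_trans (ler_normD _ _) _.
    by rewrite lerD2l normrZ gtr0_norm.
  (* As [W <= c], the bound in [upper] is at most [W + tau - gap i0]; comparison with [lower] leaves
     the gap. *)
  have : W * (tau / c) <= tau.
    rewrite mulrA ler_pdivrMr// mulrC ler_pM2l//; exact: ac.
  lra.
have /cvgrPdist_lt /(_ (gap i0 / tau)) := cvx.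
rewrite divr_gt0// => /(_ isT) [N _ near_x].
have := near_x (maxn N i0.+1) (leq_maxl _ _).
have := far (maxn N i0.+1) (leq_maxr _ _).
rewrite /= -/(S _) => h1; rewrite ltNge => /negP; apply.
by rewrite ler_pdivrMr// mulrC.
Qed.

Lemma normalized_ARS_net (R : realType) (X : completeNormedModType R)
    (D : set X) (c tau : R) :
  normalized D -> (exists x : X, x != 0) -> 1 < c -> 0 < tau < 1 ->
  modulus_of_smoothness X tau / tau <= (4 * c)^-1 ->
  is_ARS c D ->
  is_net (1 - tau / (3 * c)) (pm_scale (2 * tau / 3) D) (unit_ball X).
Proof.
move=> D1 [x0 x0n] c1 /andP[tau0 tau1] rho ars x /= xle1.
have c0 : 0 < c by lra.
have rho_le : 2 * modulus_of_smoothness X tau <= tau / c / 2.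
  move: rho; rewrite ler_pdivrMr// => h.
  have -> : tau / c / 2 = 2 * ((4 * c)^-1 * tau) by field; lra.
  by rewrite ler_pM2l.
(* At [x = 0] any unit vector serves as [u]; one exists since the space is nonzero. *)
have [l [u [l01 u1 xE]]] : exists (l : R) (u : X), [/\ 0 <= l <= 1, `|u| = 1 & x = l *: u].
  have norm1 (y : X) : y != 0 -> `| `|y|^-1 *: y| = 1.
    by move=> y0; rewrite normrZ normfV normr_id mulVf// normr_eq0.
  have [->|xn0] := eqVneq x 0.
    by exists 0, (`|x0|^-1 *: x0); rewrite lexx ler01 norm1// scale0r.
  exists `|x|, (`|x|^-1 *: x); split; first by rewrite normr_ge0.
    exact: norm1.
  by rewrite scalerA divff ?normr_eq0// scale1r.
have Bu : unit_ball X u by rewrite /unit_ball /= u1.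
have [a [d [Dd cvu suma]]] := ars u Bu.
have ac n : \sum_(0 <= i < n) `|a i| <= c.
  rewrite -lee_fin -sumEFin; apply: le_trans suma.
  rewrite (eq_bigr (fun i => `|a i *: d i|%:E)); last first.
    by move=> i _; rewrite normrZ (D1 _ (Dd i)) mulr1.
  exact: nneseries_lim_ge.
have [i ai0 far] := cvg_series_norm_direction c0 tau0 u1 cvu ac.
set e := Num.sg (a i) *: d i in far.
have e1 : `|e| = 1 by rewrite normrZ normr_sg ai0 mul1r (D1 _ (Dd i)).
(* The norms at [u + tau *: e] and [u - tau *: e] sum to at most [2 + tau / c / 2], of which [far]
   takes [1 + tau / c]. *)
have close : `|u - tau *: e| <= 1 - tau / c / 2.
  have te : `|tau *: e| <= tau by rewrite normrZ e1 mulr1 gtr0_norm.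
  have := modulus_of_smoothnessP u1 te; lra.
exists ((2 * tau / 3) *: e).
  have [ai|ai|ai] := ltrgt0P (a i); last by rewrite ai eqxx in ai0.
  - by left; exists (d i) => //; rewrite /e gtr0_sg// scale1r.
  - by right; exists (d i) => //; rewrite /e ltr0_sg// scaleN1r scalerN.
(* [u - (2 * tau / 3) *: e] lies two thirds of the way from [u] to [u - tau *: e], so its norm is at
   most [1 - tau / (3 * c)]. The weight [1 - l] falls on a vector of norm [2 * tau / 3], which is
   below the same bound because [tau < 1 < c]. *)
have -> : x - (2 * tau / 3) *: e =
    (l / 3) *: u + (l * 2 / 3) *: (u - tau *: e)
    - ((1 - l) * (2 * tau / 3)) *: e.
  rewrite xE scalerBr addrA -(scalerDl u) (scalerA _ tau e) -addrA -opprD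
    -(scalerDl e).
  by congr (_ *: _ - _ *: _); field.
have /andP[l0 l1] := l01.
have s0 : 0 <= (1 - l) * (2 * tau / 3) by rewrite mulr_ge0; lra.
apply: le_trans (ler_normB _ _) _.
rewrite [`|_ *: e|]normrZ e1 (ger0_norm s0) mulr1.
apply: (@le_trans _ _ (l / 3 + (l * 2 / 3) * (1 - tau / c / 2)
   + (1 - l) * (2 * tau / 3))).
  rewrite lerD2r; apply: le_trans (ler_normD _ _) _.
  rewrite !normrZ u1 mulr1 !ger0_norm; [|lra..].
  by rewrite lerD2l ler_wpM2l//; lra.
have -> : tau / (3 * c) = tau / c / 3 by field; lra.
have tc : tau / c <= tau by rewrite ler_pdivrMr// ler_peMr; lra.
have : 0 <= (1 - l) * (1 - tau / c / 3 - 2 * tau / 3) by rewrite mulr_ge0; lra.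
lra.
Qed.

Lemma normalized_net_ARS (R : realType) (X : completeNormedModType R)
    (D : set X) (t eps : R) :
  normalized D -> 0 < t -> 0 < eps < 1 ->
  is_net eps (pm_scale t D) (unit_ball X) -> is_ARS (t / (1 - eps)) D.
Proof.
move=> D1 t0 /andP[eps0 eps1] net x xle1.
have [f fP] : {f : X -> R * X & forall u, unit_ball X u ->
    [/\ D (f u).2, `|(f u).1| = t & `|u - (f u).1 *: (f u).2| <= eps]}.
  apply: (@choice _ _ (fun u p => unit_ball X u ->
    [/\ D p.2, `|p.1| = t & `|u - p.1 *: p.2| <= eps])) => u.
  (* Outside the unit ball [(0, 0)] is a dummy value. *)
  have [|u1] := pselect (unit_ball X u); last by exists (0, 0).
  move=> /net[_ [[d Dd <-]|[d Dd <-]] ud].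
  - by exists (t, d) => _; rewrite gtr0_norm.
  - by exists (- t, d) => _; rewrite normrN gtr0_norm// scaleNr.
pose g u := (f u).1 *: (f u).2.
(* The remainder after [n] approximations, magnified by [eps^-n]; the net error [eps] keeps it in
   the unit ball. *)
pose z n := iter n (fun u => eps^-1 *: (u - g u)) x.
have zS n : z n.+1 = eps^-1 *: (z n - g (z n)) by [].
have z1 n : unit_ball X (z n).
  elim: n => [//|n IHn]; rewrite zS /unit_ball /=.
  have [_ _ h] := fP _ IHn.
  by rewrite normrZ gtr0_norm ?invr_gt0// mulrC ler_pdivrMr// mul1r.
pose a n := eps ^+ n * (f (z n)).1.
pose d n := (f (z n)).2.
have Dd i : D (d i) by have [] := fP _ (z1 i).
have nad i : `|a i *: d i| = geometric t eps i.
  have [_ h _] := fP _ (z1 i).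
  rewrite normrZ (D1 _ (Dd i)) mulr1 /a normrM h ger0_norm ?exprn_ge0 ?ltW//.
  by rewrite mulrC.
have xE n : x - series (fun i => a i *: d i) n = eps ^+ n *: z n.
  elim: n => [|n IHn]; first by rewrite /series /= big_geq// subr0 expr0 scale1r.
  rewrite /series /= big_nat_recr//= opprD addrA.
  rewrite -[X in X - _]/(x - series (fun i => a i *: d i) n) IHn.
  rewrite scalerA exprSr mulfK ?gt_eqF// scalerBr.
  by rewrite /a /d /g scalerA.
have neps : `|eps| < 1 by rewrite gtr0_norm.
exists a, d; split=> //.
- have /cvgrPdist_lt cve := cvg_expr neps.
  apply/cvgrPdist_lt => e e0; have := cve e e0; apply: filterS => n /=.
  rewrite sub0r normrN xE => h.
  apply: le_lt_trans h; rewrite normrZ ler_piMr//; exact: z1.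
(* The norms of the terms are [t * eps ^+ i], whose partial sums increase to [t / (1 - eps)]. *)
- have cvs := @cvg_geometric_series _ t _ neps.
  under eq_eseriesr => i _ do rewrite nad.
  apply: lime_le.
    by apply: is_cvg_nneseries => i _ _; rewrite -nad lee_fin.
  apply: nearW => n; rewrite sumEFin lee_fin.
  rewrite -(cvg_lim _ cvs)//.
  apply: (@nondecreasing_cvgn_le _ (series (geometric t eps))).
    by apply: nondecreasing_series => i _ _; rewrite -nad.
  by apply/cvg_ex; exists (t / (1 - eps)).
Qed.

(* The function [c'] is chosen before the space, the set D, c and tau: this is
   the dependence of the constant on t and eps only. *)
Theorem theorem3p1 (R : realType) :
  exists c' : R -> R -> R,
  forall (X : completeNormedModType R) (D : set X) (c : R),
    (exists x : X, x != 0) ->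
    normalized D ->
    1 < c ->
    forall tau : R,
    0 < tau < 1 ->
    modulus_of_smoothness X tau / tau <= (4 * c)^-1 ->
    (is_ARS c D ->
       is_net (1 - tau / (3 * c)) (pm_scale (2 * tau / 3) D) (unit_ball X)) /\
    (forall t eps : R,
       0 < t -> 0 < eps < 1 ->
       is_net eps (pm_scale t D) (unit_ball X) ->
       is_ARS (c' t eps) D).
Proof.
exists (fun t eps => t / (1 - eps)) => X D c X0 D1 c1 tau tau01 rho; split.
- exact: normalized_ARS_net.
- by move=> t eps; exact: normalized_net_ARS.
Qed.
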